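(* Let $k\ge1$ and let $\mu=(k+1,a_0,a_1,a_2,\ldots)$ be a strict partition with $k>a_0\ge0$ (here $a_j$ denotes the $(j+2)$-nd part of $\mu$, possibly $0$). Then $$|\mathrm{Av}_n(\mu)|=\frac{n^{k-1}}{(k-1)!\prod_{j=0}^{k-1}\bigl(k-(a_j+j)\bigr)}+E(n),$$ where $E(n)=0$ if $k=1$, $E(n)=O(1)$ if $k=2$, and $E(n)=O\!\left(\sigma_{k-2}(n)\log^{k-1}n\right)$ if $k\ge3$.
   Context: A partition is a weakly decreasing sequence of nonnegative integers with finitely many nonzero parts, identified with its Ferrers board. $\alpha$ contains $\mu$ if one can delete some rows and some columns of the Ferrers board of $\alpha$ so that after top/left-justifying one obtains $\mu$; otherwise $\alpha$ avoids $\mu$. $\mathrm{Av}_n(\mu)$ is the set of partitions of weight $n$ avoiding $\mu$. Strict: positive parts distinct. $\sigma_i(n)=\sum_{d\mid n}d^i$. Implied constants may depend on $\mu$. *)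

(* Defs.v *)
From Stdlib Require Import Reals.
From mathcomp Require Import all_boot.
Set Implicit Arguments. Unset Strict Implicit. Unset Printing Implicit Defensive.

Definition is_partition (a : seq nat) : bool :=
  sorted geq a && all (fun x => 0 < x) a.

(* Ferrers board of a: cells (i, j) with j < nth 0 a i.  Keeping the rows
   selected by the mask r and the columns selected by the mask c (all other
   rows/columns deleted) and top/left-justifying, row i (if kept) has
   count (fun j => j < a_i) (kept columns) cells; empty rows disappear.
   Columns beyond head a are empty, so masks over iota 0 (head 0 a) suffice. *)
Definition contains (a mu : seq nat) : bool :=
  [exists r : (size a).-tuple bool, exists c : (head 0 a).-tuple bool,
     filter (fun x => 0 < x)
       [seq count (fun j => j < nth 0 a i) (mask c (iota 0 (head 0 a)))
          | i <- mask r (iota 0 (size a))] == mu].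

Definition avoids (a mu : seq nat) : bool := ~~ contains a mu.

(* All partitions of weight n: each has at most n parts, each at most n. *)
Definition partitions (n : nat) : seq (seq nat) :=
  [seq a <- undup [seq filter (fun x => 0 < x) (map val (tval t))
                    | t : n.-tuple 'I_n.+1]
     | is_partition a && (sumn a == n)].

Definition Av_card (n : nat) (mu : seq nat) : nat :=
  count (fun a => avoids a mu) (partitions n).

Definition sigma_div (i n : nat) : nat := \sum_(d <- divisors n) d ^ i.

(* (k-1)! * prod_{j=0}^{k-1} (k - (a_j + j)), where a_j = nth 0 s j
   (under the hypotheses every factor is a positive integer, so the
   truncated subtraction is harmless). *)
Definition main_denom (k : nat) (s : seq nat) : nat :=
  (k.-1)`! * \prod_(j < k) (k - (nth 0 s j + j)).

(* Main.v *)
Require Import Defs.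
From Stdlib Require Import Reals Lra Lia.
From mathcomp Require Import all_boot zify.
Set Implicit Arguments. Unset Strict Implicit. Unset Printing Implicit Defensive.

(** Write f(mu, n) for the number of partitions of n avoiding mu. Put rest for
    (a_1, a_2, ...) and p = k - a_0. Replacing the largest part u by u - p is a
    bijection from the partitions of n that avoid (k+1, a_0, rest) but contain
    (k, rest) onto the partitions of n - p that avoid (k+1, a_0, rest) but
    contain (a_0, rest). Hence
      f((k+1, a_0, rest), n) - f((k+1, a_0, rest), n - p)
        = f((k, rest), n) - f((a_0, rest), n - p).
    A partition avoiding (a_0, rest) has fewer than a_0 <= k - 1 distinct part
    sizes, and a partition of weight at most n with at most r distinct sizes is
    given by r pairs (m, t) with m t <= n, so that the last terms sum to
    O((n log n)^(k-2)). Summing the recurrence, by induction on k, gives the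
    stated main term with error O((n log n)^(k-2)), and
    n^(k-2) <= sigma_(k-2)(n). *)

(** * Containment of a strict partition as a chain condition on the parts *)

Lemma geq_trans : transitive geq. Proof. by move=> u v w /=; lia. Qed.
Lemma geq_total : total geq. Proof. by move=> u v /=; lia. Qed.
Lemma geq_anti : antisymmetric geq. Proof. by move=> u v /=; lia. Qed.
Lemma gt_trans : transitive gtn. Proof. by move=> u v w /=; lia. Qed.

(* Keeping rows of lengths b_1 > b_2 > ... produces mu for a suitable choice of
   columns iff b_i - b_(i+1) >= mu_i - mu_(i+1) for all i. [reach a mu x] says that
   the parts of a contain such a chain with b_1 = x. *)
Fixpoint reach (a mu : seq nat) (x : nat) : bool :=
  if mu is m :: mu' then
    (x \in a) && has (fun y => reach a mu' y && (y + (m - head 0 mu') <= x)) (iota 0 x.+1)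
  else x == 0.

Lemma reach_consP a m mu x :
  reflect (x \in a /\ exists y, reach a mu y /\ y + (m - head 0 mu) <= x)
          (reach a (m :: mu) x).
Proof.
apply: (iffP andP) => -[xa].
  by case/hasP => y _ /andP[ry le]; split=> //; exists y.
case=> y [ry le]; split=> //; apply/hasP; exists y; last by apply/andP.
by rewrite mem_iota; lia.
Qed.

(** A chain from [x] descends, so it never meets a part above [x]. This carries chains through the
    bijection below, which alters one large part only. *)
Lemma eq_reach a b mu x :
  (forall z, z <= x -> (z \in a) = (z \in b)) -> reach a mu x -> reach b mu x.
Proof.
elim: mu x => [//|m mu IH] x eqab /reach_consP[xa [y [ry le]]].
apply/reach_consP; split; first by rewrite -eqab.
exists y; split=> //; apply: IH ry => z zy; apply: eqab; lia.
Qed.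

(** Used with [f x] the number of kept columns among the first [x] and [b] the kept rows: at most x
    - y columns are kept between y and x. The last two conclusions feed the induction, as they give
    the next gap and y <= x. *)
Lemma reach_of_count (a : seq nat) (f : nat -> nat) (b : seq nat) :
  f 0 = 0 -> (forall x y, y <= x -> y + (f x - f y) <= x) ->
  sorted geq b -> {subset b <= a} ->
  exists x, [/\ reach a (filter (fun x => 0 < x) (map f b)) x,
                f x = head 0 (filter (fun x => 0 < x) (map f b))
              & (x == 0) || (x \in b)].
Proof.
move=> f0 fL; elim: b => [|x b IH] /= sb ba; first by exists 0.
have ba' : {subset b <= a} by move=> z zb; apply: ba; rewrite inE zb orbT.
have [y [ry fy yb]] := IH (path_sorted sb) ba'.
case: ifP => fx; last first.
  exists y; split=> //; case/orP: yb => [->//|yb]; by rewrite inE yb !orbT.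
exists x; split=> //; last by rewrite mem_head orbT.
apply/reach_consP; split; first by apply: ba; rewrite mem_head.
exists y; split=> //; rewrite -fy; apply: fL.
case/orP: yb => [/eqP->//|yb].
by move/(order_path_min geq_trans)/allP/(_ _ yb): sb.
Qed.

(** Since [mu] is strict, every required gap is positive, so the chain is strictly decreasing and
    the columns can be chosen gap by gap. *)
Lemma reach_chain a mu x :
  sorted gtn mu -> all (fun x => 0 < x) mu -> reach a mu x ->
  exists (b : seq nat) (P : pred nat),
    [/\ sorted gtn b, {subset b <= a}, head 0 b = x &
        map (fun v => count P (iota 0 v)) b = mu].
Proof.
elim: mu x => [|m mu IH] x smu; first by move=> _ /eqP->; exists [::], xpred0.
case/andP=> m0 pmu /reach_consP[xa [y [ry le]]].
have [b [P [sb ba hb eb]]] := IH _ (path_sorted smu) pmu ry.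
have lt : head 0 mu < m.
  by case: mu smu {IH pmu ry le eb} => //= w mu /andP[].
have hm v : v \in b -> v <= y.
  case: b sb hb {ba eb} => //= w b /(order_path_min gt_trans)/allP wb <-.
  by rewrite inE => /orP[/eqP->//|/wb /=]; lia.
(* Below [y] the columns chosen for the tail stay; from [y] on, only the first [m - head 0 mu] are
   added, and these fit below [x]. *)
pose Q j := if j < y then P j else j < y + (m - head 0 mu).
have cQ v : v <= y -> count Q (iota 0 v) = count P (iota 0 v).
  move=> vy; apply: eq_in_count => j; rewrite mem_iota /Q => /andP[_ jv].
  by rewrite ifT //; lia.
have cPy : count P (iota 0 y) = head 0 mu.
  by rewrite -eb; case: b hb {sb ba eb hm} => //= [<-|v b ->].
have cx : count Q (iota 0 x) = m.
  have -> : x = y + ((m - head 0 mu) + (x - y - (m - head 0 mu))) by lia.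
  rewrite !iotaD !count_cat !add0n cQ // cPy.
  rewrite (@eq_in_count _ _ predT) ?count_predT ?size_iota.
    rewrite (@eq_in_count _ _ pred0) ?count_pred0; first by lia.
    by move=> j; rewrite mem_iota /Q /= => ?; case: ifP; lia.
  by move=> j; rewrite mem_iota /Q /= => ?; case: ifP; lia.
exists (x :: b), Q; split=> //.
- rewrite /= (path_min_sorted (x := x)) //.
  by apply/allP => v /hm /=; lia.
- by move=> z; rewrite inE => /orP[/eqP->|/ba].
rewrite /= cx; congr (_ :: _); rewrite -[RHS]eb.
by apply/eq_in_map => v /hm /cQ.
Qed.

Lemma map_nth_mask (f : nat -> nat) (r : bitseq) (a : seq nat) :
  [seq f (nth 0 a i) | i <- mask r (iota 0 (size a))] = map f (mask r a).
Proof.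
by rewrite -[in RHS](mkseq_nth 0 a) /mkseq -map_mask -map_comp.
Qed.

Lemma containsP a mu : is_partition a -> sorted gtn mu -> all (fun x => 0 < x) mu ->
  reflect (exists x, reach a mu x) (contains a mu).
Proof.
move=> /andP[sa pa] smu pmu; apply: (iffP existsP).
  case=> r /existsP[c /eqP eqmu].
  pose cols := mask c (iota 0 (head 0 a)).
  pose f x := count (fun j => j < x) cols.
  have ucols : uniq cols by apply/mask_uniq/iota_uniq.
  have f0 : f 0 = 0 by rewrite /f (eq_count (a2 := pred0)) ?count_pred0.
  have fL x y : y <= x -> y + (f x - f y) <= x.
    move=> yx; suff: f x <= f y + (x - y) by lia.
    rewrite /f -!size_filter.
    have -> : size [seq j <- cols | j < y] + (x - y) =
      size ([seq j <- cols | j < y] ++ iota y (x - y)) by rewrite size_cat size_iota.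
    (* Kept columns are distinct, and those counted by [f x] but not by [f y] lie in the window from
       [y] to [x]. *)
    apply: uniq_leq_size; first exact: filter_uniq.
    move=> j; rewrite mem_cat !mem_filter mem_iota => /andP[jx ->].
    by case: (ltnP j y) => //=; lia.
  have E : [seq count (fun j => j < nth 0 a i) cols | i <- mask r (iota 0 (size a))]
         = map f (mask r a) := map_nth_mask f r a.
  have sm : sorted geq (mask r a) by exact: (subseq_sorted geq_trans (mask_subseq r a) sa).
  have ma : {subset mask r a <= a} by move=> z /mem_mask.
  have [x [rx _ _]] := reach_of_count f0 fL sm ma.
  by exists x; rewrite -E eqmu in rx.
case=> x /(reach_chain smu pmu)[b [P [sb ba _ eb]]].
have sba : subseq b a.
  (* Both sides are strictly decreasing with the same members, so [b] is a subsequence of [a] and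
     comes from a row mask. *)
  have -> : b = filter (mem b) (undup a).
    apply: (irr_sorted_eq gt_trans) => //; first by move=> u /=; lia.
      apply: (sorted_filter gt_trans).
      have := subseq_sorted geq_trans (undup_subseq a) sa.
      have := undup_uniq a; elim: (undup a) => // v l IH /= /andP[vl ul] pv.
      have := order_path_min geq_trans pv => /allP am.
      rewrite (path_min_sorted (x := v)); first exact: IH ul (path_sorted pv).
      apply/allP => z zl; have /= := am _ zl.
      by have : v != z by [apply: contraNneq vl => ->]; lia.
    move=> z; rewrite mem_filter mem_undup.
    by apply/idP/andP => [zb|[]//]; split=> //; apply: ba.
  exact: subseq_trans (filter_subseq _ _) (undup_subseq _).
case/subseqP: sba => r sr br.
have sr' : size r == size a by rewrite sr.
exists (Tuple sr').
have sc : size (map P (iota 0 (head 0 a))) == head 0 a by rewrite size_map size_iota.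
apply/existsP; exists (Tuple sc); apply/eqP => /=.
rewrite -filter_mask -[RHS](all_filterP pmu); congr filter.
rewrite -[RHS]eb br -(map_nth_mask (fun v => count P (iota 0 v))).
apply/eq_in_map => i /mem_mask; rewrite mem_iota /= => ia.
rewrite count_filter.
have le : nth 0 a i <= head 0 a.
  rewrite -nth0.
  have rg : reflexive geq by move=> u /=.
  have := sorted_leq_nth geq_trans rg 0 sa; apply => //; rewrite ?inE; lia.
rewrite -(subnKC le) iotaD count_cat add0n.
rewrite [X in _ + X](_ : _ = 0) ?addn0; last first.
  apply/eqP; rewrite -leqn0 leqNgt -has_count; apply/hasPn => j /=.
  by rewrite mem_iota => /andP[h _]; rewrite negb_and -leqNgt h.
by apply: eq_in_count => j /=; rewrite mem_iota => /andP[_ ->].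
Qed.

(** * The enumeration of the partitions of n *)

Lemma mem_partitions n a : (a \in partitions n) = is_partition a && (sumn a == n).
Proof.
rewrite mem_filter mem_undup andbC.
case: (boolP (is_partition a && _)) => [/andP[/andP[sa pa] /eqP sn]|]; last by rewrite andbF.
rewrite andbT.
have sz : size a <= n.
  rewrite -sn; elim: a pa {sa sn} => //= x a IH /andP[x0 /IH]; lia.
have mx x : x \in a -> x <= n.
  rewrite -sn; elim: a {sa pa sn sz} => //= y a IH; rewrite inE => /orP[/eqP->|/IH]; lia.
(* Padding by zeros gives a tuple of length [n]; the filter in [partitions] removes them again. *)
pose b := map (@inord n) (a ++ nseq (n - size a) 0).
have sb : size b == n by rewrite size_map size_cat size_nseq subnKC.
apply/mapP; exists (Tuple sb) => /=; first by rewrite mem_enum.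
rewrite -map_comp map_id_in.
  by rewrite filter_cat (all_filterP pa) filter_nseq /= cats0.
move=> x; rewrite mem_cat => /orP[/mx xn|/nseqP[-> _]] /=; by rewrite inordK.
Qed.

Lemma partitions_uniq n : uniq (partitions n).
Proof. exact/filter_uniq/undup_uniq. Qed.

Lemma partition_le_head a x : is_partition a -> x \in a -> x <= head 0 a.
Proof.
case: a => //= y a /andP[/= /(order_path_min geq_trans)/allP ya _].
by rewrite inE => /orP[/eqP->//|/ya].
Qed.

Lemma partition_pos a x : is_partition a -> x \in a -> 0 < x.
Proof. by case/andP=> _ /allP h /h. Qed.

(** * The bijection that shifts the largest part *)

(* The two directions of the bijection behind [Av_card_rec]. When a avoids
   [:: k.+1, a0 & rest] and p = k - a0, the least t at which a0 :: rest can be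
   reached satisfies u <= t + p for every part u of a. Hence the part t + p made
   by [raise] becomes the largest one, and the part u - p made by [lower] becomes
   the least reachable t. *)
Definition lower p (a : seq nat) : seq nat := sort geq (head 0 a - p :: behead a).

Definition low_part (mu a : seq nat) : nat :=
  find (reach a mu) (iota 0 (head 0 a).+1).

Definition raise p mu (a : seq nat) : seq nat :=
  let t := low_part mu a in (t + p) :: rem t a.

(** A chain for a nonempty [mu] starts at a part, hence at most at [head 0 a], so the search in
    [low_part] cannot fail. *)
Lemma low_partP mu a : mu != [::] -> is_partition a -> (exists x, reach a mu x) ->
  reach a mu (low_part mu a) /\ forall x, reach a mu x -> low_part mu a <= x.
Proof.
case: mu => // m mu _ pa [x rx].
have xh y : reach a (m :: mu) y -> y \in iota 0 (head 0 a).+1.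
  by case/reach_consP=> ya _; rewrite mem_iota /= ltnS; apply: partition_le_head.
have hs : has (reach a (m :: mu)) (iota 0 (head 0 a).+1).
  by apply/hasP; exists x => //; apply: xh.
have := nth_find 0 hs; rewrite nth_iota; last first.
  by rewrite -[X in _ < X](size_iota 0) -has_find.
rewrite add0n => rt; split=> // y ry; rewrite leqNgt; apply/negP => lt.
have := before_find 0 lt; rewrite nth_iota ?ry //.
by move: (xh _ ry); rewrite mem_iota.
Qed.

Section Shift.
Variables (k a0 : nat) (rest : seq nat).
Hypotheses (smu : sorted gtn [:: k.+1, a0 & rest])
  (pmu : all (fun x => 0 < x) [:: k.+1, a0 & rest]) (ka : a0 < k).
Let p := k - a0.

Let upper a := [/\ is_partition a, ~ (exists x, reach a [:: k.+1, a0 & rest] x)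
                 & exists x, reach a (k :: rest) x].
Let lowr a := [/\ is_partition a, ~ (exists x, reach a [:: k.+1, a0 & rest] x)
                 & exists x, reach a (a0 :: rest) x].

Lemma head_lt_a0 : head 0 rest < a0.
Proof. by case: rest smu pmu => [|r s] /=; [move=> _ /andP[] | case/and3P]. Qed.

Lemma lower_lowr a : upper a ->
  [/\ lowr (lower p a), raise p (a0 :: rest) (lower p a) = a
    & p + sumn (lower p a) = sumn a].
Proof.
move=> [pa av [x /reach_consP[xa [y [ry le]]]]].
have hl := head_lt_a0.
set u := head 0 a.
have xu : x <= u := partition_le_head pa xa.
have ua : u \in a by rewrite /u; case: (a) xa => // v b _; exact: mem_head.
(* The gap [k - head 0 rest] below [x] exceeds [p], because [head 0 rest < a0]. *)
have up : p < u by rewrite /p in av *; lia.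
have ea : a = u :: behead a by rewrite /u; case: (a) xa.
have pb : perm_eq (lower p a) (u - p :: behead a) by rewrite perm_sort.
have mb z : (z \in lower p a) = (z == u - p) || (z \in behead a).
  by rewrite (perm_mem pb) inE.
have pl : is_partition (lower p a).
  rewrite /is_partition sort_sorted ?(perm_all _ pb) /=; last exact: geq_total.
  case/andP: pa => _; rewrite {1}ea /= => /andP[_ ->]; rewrite subn_gt0 up //.
have eqm z : z < u - p -> (z \in lower p a) = (z \in a).
  by move=> zu; rewrite mb [in RHS]ea inE; congr orb; lia.
have sl : p + sumn (lower p a) = sumn a.
  by rewrite (perm_sumn pb) [in RHS]ea /=; lia.
(* Such a chain would survive in [a], and t + p + 1 <= u lets [u] be put in front of it, giving the
   forbidden chain. *)
have avl : forall t, t < u - p -> ~ reach (lower p a) (a0 :: rest) t.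
  move=> t tu rt; apply: av; exists u; apply/reach_consP; split=> //.
  exists t; split; last by move: tu; rewrite /= /p; lia.
  by apply: eq_reach rt => z zt; apply: eqm; apply: leq_ltn_trans zt tu.
(* The gaps below [k] and below [a0] differ by exactly [p], so u - p still clears [y]. With [avl], u
   - p is the least start. *)
have ru : reach (lower p a) (a0 :: rest) (u - p).
  apply/reach_consP; split; first by rewrite mb eqxx.
  exists y; split; last by rewrite /p; lia.
  by apply: eq_reach ry => z zy; rewrite eqm //; rewrite /p; lia.
have lo : lowr (lower p a).
  split=> //; last by exists (u - p).
  move=> [z /reach_consP[zl [t [rt tz]]]].
  apply: (avl t _ rt); have : z <= u; last by move: tz; rewrite /= /p; lia.
  move: zl; rewrite mb => /orP[/eqP->|zb]; first by lia.
  by apply: partition_le_head => //; rewrite ea inE zb orbT.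
have lp : low_part (a0 :: rest) (lower p a) = u - p.
  have [//|rt mt] := @low_partP (a0 :: rest) _ _ pl (ex_intro (reach _ _) _ ru).
  have := mt _ ru; case: (ltnP (low_part (a0 :: rest) (lower p a)) (u - p)); last by lia.
  by move=> /avl.
split=> //.
rewrite /raise lp subnK ?(ltnW up) // [RHS]ea; congr (_ :: _).
apply: (sorted_eq geq_trans geq_anti).
- by apply: (subseq_sorted geq_trans (rem_subseq _ _)); case/andP: pl.
- by case/andP: pa; rewrite {1}ea => /path_sorted.
rewrite -(perm_cons (u - p)) -(permPr pb) perm_sym perm_to_rem //.
by rewrite mb eqxx.
Qed.

Lemma raise_upper a : lowr a ->
  [/\ upper (raise p (a0 :: rest) a), lower p (raise p (a0 :: rest) a) = a
    & sumn (raise p (a0 :: rest) a) = p + sumn a].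
Proof.
move=> [pa av ex].
have hl := head_lt_a0.
have [//|] := low_partP _ pa ex; rewrite /raise.
set t := low_part _ _ => rt mt.
have /reach_consP[ta [y [ry le]]] := rt.
have tp z : z \in a -> z <= t + p.
  move=> za; rewrite leqNgt; apply/negP => lt; apply: av; exists z.
  apply/reach_consP; split=> //; exists t; split=> //=; rewrite /p in lt; lia.
have pt : perm_eq a (t :: rem t a) := perm_to_rem ta.
have sr : sorted geq (t + p :: rem t a).
  rewrite /= (path_min_sorted (x := t + p)).
    by apply: (subseq_sorted geq_trans (rem_subseq _ _)); case/andP: pa.
  by apply/allP => z /mem_rem /tp.
have eqm z : z < t -> (z \in t + p :: rem t a) = (z \in a).
  by move=> zt; rewrite (perm_mem pt) !inE; congr orb; lia.
split.
- split.
  + rewrite /is_partition sr /= addn_gt0 (partition_pos pa ta) /=.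
    by apply/allP => z /mem_rem /(partition_pos pa).
  (* A forbidden chain starts at most at t + p, so its second term is below [t], where the parts are
     those of [a]; this contradicts the minimality of [t]. *)
  + move=> [x /reach_consP[xr [t' [rt' le']]]].
    have xt : x <= t + p.
      by move: xr; rewrite inE => /orP[/eqP->//|/mem_rem/tp].
    have tt : t' < t by move: le'; rewrite /= /p in xt *; lia.
    suff /mt : reach a (a0 :: rest) t' by lia.
    by apply: eq_reach rt' => z zt; apply: eqm; lia.
  + exists (t + p); apply/reach_consP; split; first exact: mem_head.
    exists y; split; last by rewrite /p; lia.
    by apply: eq_reach ry => z zy; rewrite eqm //; lia.
- rewrite /lower /= addnK; apply: (sorted_eq geq_trans geq_anti).
  + exact: sort_sorted geq_total _.
  + by case/andP: pa.
  by rewrite perm_sort perm_sym.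
by rewrite (perm_sumn pt) /=; lia.
Qed.

End Shift.

(** * The recurrence for the number of avoiding partitions *)

Lemma leq_size_in_inj (T1 T2 : eqType) (f : T1 -> T2) (s1 : seq T1) (s2 : seq T2) :
  uniq s1 -> {in s1 &, injective f} -> (forall x, x \in s1 -> f x \in s2) ->
  size s1 <= size s2.
Proof.
move=> u1 fi fs; rewrite -(size_map f); apply: uniq_leq_size.
  by rewrite map_inj_in_uniq.
by move=> y /mapP[x xs ->]; apply: fs.
Qed.

Lemma count_partitionsE (P Q : pred (seq nat)) n m (f g : seq nat -> seq nat) :
  (forall a, is_partition a -> sumn a = n -> P a ->
     [/\ is_partition (f a), sumn (f a) = m, Q (f a) & g (f a) = a]) ->
  (forall a, is_partition a -> sumn a = m -> Q a ->
     [/\ is_partition (g a), sumn (g a) = n, P (g a) & f (g a) = a]) ->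
  count P (partitions n) = count Q (partitions m).
Proof.
move=> fP gP; rewrite -!size_filter.
have mF R l a : (a \in [seq b <- partitions l | R b]) =
    [&& R a, is_partition a & sumn a == l] by rewrite mem_filter mem_partitions.
apply/eqP; rewrite eqn_leq; apply/andP; split.
  apply: (@leq_size_in_inj _ _ f); first exact/filter_uniq/partitions_uniq.
    move=> a b; rewrite !mF => /and3P[Pa pa /eqP na] /and3P[Pb pb /eqP nb] e.
    have [_ _ _ <-] := fP _ pa na Pa; have [_ _ _ <-] := fP _ pb nb Pb.
    by rewrite e.
  move=> a; rewrite !mF => /and3P[Pa pa /eqP na].
  by have [-> -> -> _] := fP _ pa na Pa; rewrite eqxx.
apply: (@leq_size_in_inj _ _ g); first exact/filter_uniq/partitions_uniq.
  move=> a b; rewrite !mF => /and3P[Pa pa /eqP na] /and3P[Pb pb /eqP nb] e.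
  have [_ _ _ <-] := gP _ pa na Pa; have [_ _ _ <-] := gP _ pb nb Pb.
  by rewrite e.
move=> a; rewrite !mF => /and3P[Pa pa /eqP na].
by have [-> -> -> _] := gP _ pa na Pa; rewrite eqxx.
Qed.

Lemma count_split (T : eqType) (P Q : pred T) (l : seq T) :
  {in l, forall x, Q x -> P x} ->
  count P l = count Q l + count (fun x => P x && ~~ Q x) l.
Proof.
elim: l => //= x l IH QP; rewrite IH; last by move=> y yl; apply: QP; rewrite inE yl orbT.
by have := QP x (mem_head _ _); case: (P x); case: (Q x) => //= h; try lia; have := h isT.
Qed.

Lemma avoidsPn a mu : is_partition a -> sorted gtn mu -> all (fun x => 0 < x) mu ->
  reflect (~ exists x, reach a mu x) (avoids a mu).
Proof.
by move=> pa sm pm; apply: (iffP negP) => h /(containsP pa sm pm).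
Qed.

Lemma Av_card_nil n : Av_card n [::] = 0.
Proof.
apply/eqP; rewrite -leqn0 leqNgt -has_count; apply/hasPn => a.
rewrite mem_partitions => /andP[pa _].
by apply/negP => /(@avoidsPn _ [::] pa isT isT) []; exists 0.
Qed.

(** This is the case a_0 = 0, where there is no second part to reach. Avoiding [[:: m.+1]] means
    having all parts at most m, and one deletes a largest part equal to k+1. *)
Lemma Av_card_rec1 k n : k.+1 <= n ->
  Av_card n [:: k.+2] = Av_card (n - k.+1) [:: k.+2] + Av_card n [:: k.+1].
Proof.
move=> kn.
have av m a : is_partition a -> avoids a [:: m.+1] = (head 0 a <= m).
  move=> pa; apply: (sameP (@avoidsPn _ [:: m.+1] pa isT isT)); apply: (iffP idP) => [h|].
    move=> [x /reach_consP[xa [y [/eqP-> /= ]]]].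
    by have := partition_le_head pa xa; lia.
  rewrite leqNgt => nx; apply/negP => h.
  apply: nx; exists (head 0 a); apply/reach_consP; split.
    by case: (a) h => //= *; exact: mem_head.
  by exists 0; split=> //=; lia.
rewrite addnC {1}/Av_card (@count_split _ _ (fun a => avoids a [:: k.+1])); last first.
  move=> a; rewrite mem_partitions => /andP[pa _]; rewrite !av //; lia.
congr (_ + _); apply: (@count_partitionsE _ _ _ _ behead (cons k.+1)).
  move=> a pa sn /=; rewrite (av _ _ pa) (av _ _ pa) -ltnNge => /andP[h1 h2].
  have ea : a = k.+1 :: behead a.
    by case: (a) h1 h2 => //= x b; move=> *; congr (_ :: _); lia.
  have pb : is_partition (behead a).
    case/andP: pa; rewrite {1 2}ea /= => /path_sorted sb /= pb; exact/andP.
  split=> //; first by rewrite -sn [in RHS]ea /=; lia.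
  rewrite av //; case: (a) pa h1 => //= x [|y b] //= /andP[/= /andP[]]; lia.
move=> a pa sn; rewrite av // => h.
have pc : is_partition (k.+1 :: a).
  case/andP: pa h => sa pa; rewrite /is_partition /= pa andbT.
  by case: (a) sa => //= x b -> ->.
by split=> //=; rewrite ?av //=; lia.
Qed.

(** Negative terms stand on the opposite side because subtraction on [nat] truncates. Each count of
    avoiders of the long pattern splits into avoiders of a shorter one and one side of the
    bijection. *)
Lemma Av_card_rec k s n (p := k.+1 - head 0 s) :
  sorted gtn (k.+2 :: s) -> all (fun x => 0 < x) s -> head 0 s < k.+1 -> p <= n ->
  Av_card n (k.+2 :: s) + Av_card (n - p) s =
  Av_card (n - p) (k.+2 :: s) + Av_card n (k.+1 :: behead s).
Proof.
rewrite {}/p; case: s => [|a0 rest] smu pmu ka pn.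
  by rewrite Av_card_nil addn0 subn0; apply: Av_card_rec1; move: pn; rewrite /= subn0.
rewrite /= in ka pn *; set p := k.+1 - a0 in pn *.
have pmu' : all (fun x => 0 < x) [:: k.+2, a0 & rest] by [].
have hl := head_lt_a0 smu pmu'.
have sa : sorted gtn (a0 :: rest) by exact: path_sorted smu.
have sk : sorted gtn (k.+1 :: rest).
  by move: sa hl; case: (rest) => //= r l /andP[_ ->]; rewrite andbT => h; lia.
have pk : all (fun x => 0 < x) (k.+1 :: rest) by case/andP: pmu.
rewrite {1}/Av_card (@count_split _ _ (fun a => avoids a (k.+1 :: rest))); last first.
  move=> a; rewrite mem_partitions => /andP[pa _].
  (* Dropping the second term of a chain for the long pattern leaves a chain for [k.+1 :: rest]. *)
  move=> /(avoidsPn pa sk pk) av; apply/(avoidsPn pa smu pmu') => -[x].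
  case/reach_consP=> xa [t [/reach_consP[ta [y [ry le]]] /= le']].
  apply: av; exists x; apply/reach_consP; split=> //; exists y; split=> //; lia.
rewrite [X in _ = X + _]/Av_card.
rewrite (@count_split _ (fun a => avoids a [:: k.+2, a0 & rest])
          (fun a => avoids a (a0 :: rest)) (partitions (n - p))); last first.
  move=> a; rewrite mem_partitions => /andP[pa _].
  move=> /(avoidsPn pa sa pmu) av; apply/(avoidsPn pa smu pmu') => -[x].
  by case/reach_consP=> xa [t [rt _]]; apply: av; exists t.
suff -> : count (fun a => avoids a [:: k.+2, a0 & rest] && ~~ avoids a (k.+1 :: rest))
    (partitions n) =
  count (fun a => avoids a [:: k.+2, a0 & rest] && ~~ avoids a (a0 :: rest))
    (partitions (n - p)).
  by rewrite /Av_card addnAC [RHS]addnAC; congr (_ + _); rewrite addnC.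
apply: (@count_partitionsE _ _ _ _ (lower p) (raise p (a0 :: rest))).
  move=> a pa sn /andP[/(avoidsPn pa smu pmu') av]; rewrite negbK.
  move=> /(containsP pa sk pk) ex.
  have [[pl avl exl] rl sl] := lower_lowr smu pmu' ka (And3 pa av ex).
  split=> //; first by rewrite -/p in sl; lia.
  apply/andP; split; first exact/(avoidsPn pl smu pmu').
  by rewrite negbK; apply/(containsP pl sa pmu).
move=> a pa sn /andP[/(avoidsPn pa smu pmu') av]; rewrite negbK.
move=> /(containsP pa sa pmu) ex.
have [[pl avl exl] rl sl] := raise_upper smu pmu' ka (And3 pa av ex).
split=> //; first by rewrite -/p in sl; lia.
apply/andP; split; first exact/(avoidsPn pl smu pmu').
by rewrite negbK; apply/(containsP pl sk pk).
Qed.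

Lemma Av_card2 n : Av_card n [:: 2] = 1.
Proof.
rewrite /Av_card (@eq_in_count _ _ (pred1 (nseq n 1))).
  rewrite count_uniq_mem ?partitions_uniq // mem_partitions /is_partition sumn_nseq mul1n eqxx andbT.
  have -> : sorted geq (nseq n 1) by elim: n => [|[|n] IH] //=.
  by rewrite all_nseq orbT.
move=> a; rewrite mem_partitions => /andP[pa /eqP sn].
apply: (sameP (@avoidsPn _ [:: 2] pa isT isT)); apply: (iffP idP) => [/eqP->|nx].
  by move=> [x /reach_consP[/nseqP[-> _] [y [/eqP-> ]]]].
apply/eqP; have h : all (pred1 1) a.
  apply/allP => x xa /=; have := partition_pos pa xa; case: (ltnP 1 x) => h; last by lia.
  by case: nx; exists x; apply/reach_consP; split=> //; exists 0.
move/all_pred1P: h => e; rewrite e; congr nseq.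
by rewrite -sn e sumn_nseq mul1n size_nseq.
Qed.

(** * Partitions with few distinct part sizes *)

Lemma sorted_ltn_nth_gap (u : seq nat) i j : sorted ltn u -> i <= j < size u ->
  nth 0 u i + (j - i) <= nth 0 u j.
Proof.
move=> su /andP[ij]; rewrite -(subnKC ij); elim: (j - i) => [|d IH] h.
  by rewrite addn0 subnn addn0.
rewrite addnS in h *.
have {}IH := IH (ltnW h).
have tr : transitive ltn by move=> x y z /=; lia.
have /= := sorted_ltn_nth tr 0 su (i + d) (i + d).+1.
rewrite !inE => /(_ (ltnW h) h (ltnSn _)) /=; lia.
Qed.

(** With [m] distinct sizes a chain is explicit: for each entry w of the pattern take the w-th
    smallest size. Increasing integers differ at least as much as their indices. *)
Lemma avoids_size_undup a m mu : is_partition a ->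
  sorted gtn (m :: mu) -> all (fun x => 0 < x) (m :: mu) ->
  avoids a (m :: mu) -> size (undup a) < m.
Proof.
move=> pa sm pm /(avoidsPn pa sm pm); rewrite ltnNge => nx; apply/negP => le.
apply: nx.
(* The leading 0 makes index w the w-th smallest size and gives the empty chain its start. *)
pose v := 0 :: sort leq (undup a).
have pv : perm_eq (sort leq (undup a)) (undup a) by rewrite perm_sort.
have sv : sorted ltn v.
  rewrite /v /= path_min_sorted.
    by rewrite ltn_sorted_uniq_leq sort_uniq undup_uniq sort_sorted //; apply: leq_total.
  by apply/allP => x; rewrite (perm_mem pv) mem_undup => /(partition_pos pa).
have szv : size v = (size (undup a)).+1 by rewrite /= (perm_size pv).
have key l : sorted gtn l -> all (fun x => 0 < x) l -> head 0 l <= size (undup a) ->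
    reach a l (nth 0 v (head 0 l)).
  elim: l => [//|w l IH] sl /andP[w0 pl] /= lw.
  have hw : head 0 l < w by case: (l) sl => //= z s /andP[].
  apply/reach_consP; split.
    rewrite -mem_undup -(perm_mem pv).
    by case: w w0 lw {sl hw} => // w _ lw; apply: mem_nth; rewrite (perm_size pv).
  exists (nth 0 v (head 0 l)); split.
    by apply: IH => //; [exact: path_sorted sl | exact: leq_trans (ltnW hw) lw].
  by apply: sorted_ltn_nth_gap => //; rewrite szv ltnS lw (ltnW hw).
by exists (nth 0 v m); apply: key.
Qed.

(** Counts the pairs of positive integers with product at most [n]. *)
Definition divsum n := \sum_(1 <= t < n.+1) n %/ t.

(** The pair (0, 0) is an empty block, so that [r] blocks also describe partitions with fewer than
    [r] sizes. *)
Definition blocks n : seq (nat * nat) :=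
  (0, 0) :: [seq (m, t) | t <- index_iota 1 n.+1, m <- iota 1 (n %/ t)].

Lemma size_blocks n : size (blocks n) = (divsum n).+1.
Proof.
rewrite /= size_allpairs_dep /divsum sumnE big_map; congr _.+1.
by apply: eq_bigr => t _; rewrite size_iota.
Qed.

Lemma mem_blocks n m t : 0 < m -> 0 < t -> m * t <= n -> (m, t) \in blocks n.
Proof.
move=> m0 t0 mt; rewrite inE; apply/orP; right.
apply/allpairsPdep; exists t, m; split=> //.
  by rewrite mem_index_iota t0 ltnS; nia.
by rewrite mem_iota m0 add1n ltnS leq_divRL.
Qed.

Fixpoint block_seqs n r : seq (seq nat) :=
  if r is r'.+1 then [seq nseq mt.1 mt.2 ++ a | mt <- blocks n, a <- block_seqs n r']
  else [:: [::]].

Lemma size_block_seqs n r : size (block_seqs n r) = (divsum n).+1 ^ r.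
Proof. by elim: r => // r IH; rewrite size_allpairs IH size_blocks expnS. Qed.

(** All copies of the largest part form one block, and the remaining parts have one size fewer. *)
Lemma mem_block_seqs n r a : is_partition a -> sumn a <= n -> size (undup a) <= r ->
  a \in block_seqs n r.
Proof.
elim: r a => [|r IH] a pa sa ua.
  by case: a ua {pa sa} => // x a; rewrite leqn0 size_eq0 => /eqP/undup_nil.
case ea : a => [|t a'].
  by apply/allpairsP; exists ((0, 0), [::]); split; [exact: mem_head | exact: IH | by []].
rewrite -ea; pose b := filter (predC1 t) a; pose m := count_mem t a.
have eq_a : a = nseq m t ++ b.
  have pt : perm_eq a (nseq m t ++ b).
    rewrite -(perm_filterC (pred1 t) a) perm_cat // perm_sym.
    by rewrite /m -size_filter (all_pred1P _ _ (filter_all (pred1 t) a)) size_nseq.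
  apply: (sorted_eq geq_trans geq_anti) pt; first by case/andP: pa.
  have sb : sorted geq b by apply: (sorted_filter geq_trans); case/andP: pa.
  have bt x : x \in b -> x <= t.
    by rewrite mem_filter => /andP[_ /(partition_le_head pa)]; rewrite ea.
  elim: m => //= d; case: d => [_|d IHd] /=; last by rewrite leqnn.
  by rewrite (path_min_sorted (x := t)) //; apply/allP => x /bt.
have m0 : 0 < m by rewrite /m ea /= eqxx.
have t0 : 0 < t by apply: (partition_pos pa); rewrite ea mem_head.
have sn : sumn a = m * t + sumn b by rewrite [in LHS]eq_a sumn_cat sumn_nseq mulnC.
apply/allpairsP; exists ((m, t), b); split=> //=.
  by apply: mem_blocks => //; lia.
apply: IH; last 1 first.
- have sub : size (t :: undup b) <= size (undup a).
    apply: uniq_leq_size; first by rewrite /= mem_undup mem_filter /= eqxx undup_uniq.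
    move=> x; rewrite inE !mem_undup mem_filter => /orP[/eqP->|/andP[]//].
    by rewrite ea mem_head.
  by move: (leq_trans sub ua).
- case/andP: pa => sa' pa; rewrite /is_partition (sorted_filter geq_trans) //.
  by apply/allP => x; rewrite mem_filter => /andP[_ /(allP pa)].
by lia.
Qed.

(** The same block sequences cover all weights up to [n], so summing over the weights costs no extra
    factor [n]. *)
Lemma sum_Av_card_le s n r : sorted gtn s -> all (fun x => 0 < x) s -> head 0 s <= r.+1 ->
  \sum_(i < n.+1) Av_card i s <= (divsum n).+1 ^ r.
Proof.
case: s => [|m mu] sm pm hm; first by rewrite big1 // => i _; apply: Av_card_nil.
have -> : \sum_(i < n.+1) Av_card i (m :: mu) =
   size [seq a | i <- iota 0 n.+1, a <- [seq a <- partitions i | avoids a (m :: mu)]].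
  rewrite size_allpairs_dep sumnE big_map -(big_mkord xpredT (fun i => Av_card i _)).
  by apply: eq_bigr => i _; rewrite size_filter.
rewrite -size_block_seqs; apply: uniq_leq_size.
  apply: allpairs_uniq_dep => //; first exact: iota_uniq.
    by move=> i _; exact/filter_uniq/partitions_uniq.
  move=> [i a] [j b] /allpairsPdep[i' [a' [_ ai [ei ea]]]].
  move=> /allpairsPdep[j' [b' [_ bj [ej eb]]]] /= eab.
  move: ai; rewrite mem_filter mem_partitions => /and3P[_ _ /eqP sa].
  move: bj; rewrite mem_filter mem_partitions => /and3P[_ _ /eqP sb].
  by subst; congr existT.
move=> a /allpairsPdep[i [b [ii bi ->]]].
move: bi; rewrite mem_filter mem_partitions => /and3P[av pb /eqP sb].
apply: mem_block_seqs => //; first by rewrite sb; move: ii; rewrite mem_iota; lia.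
by have := avoids_size_undup pb sm pm av; rewrite /= in hm; lia.
Qed.

(** * Asymptotic solution of the recurrence *)

Open Scope R_scope.

Lemma INR_leq m n : (m <= n)%N -> INR m <= INR n.
Proof. by move=> /leP /le_INR. Qed.

Lemma INR_expn m n : INR (m ^ n)%N = INR m ^ n.
Proof. by elim: n => // n IH; rewrite expnS mult_INR IH. Qed.

Lemma INR_subn m n : (n <= m)%N -> INR (m - n)%N = INR m - INR n.
Proof. by move=> /leP /minus_INR. Qed.

Definition blockW n : R := INR (divsum n).+1.

Lemma divsum_ge n : (n <= divsum n)%N.
Proof.
case: n => // n; rewrite /divsum big_ltn // divn1; exact: leq_addr.
Qed.

Lemma divsum_mono m n : (m <= n)%N -> (divsum m <= divsum n)%N.
Proof.
move=> mn; rewrite /divsum [X in (_ <= X)%N](@big_cat_nat _ _ _ m.+1) //.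
by apply: leq_trans (leq_addr _ _); apply: leq_sum => t _; apply: leq_div2r.
Qed.

Lemma blockW_ge1 n : 1 <= blockW n.
Proof. by rewrite -[1]/(INR 1); apply: INR_leq. Qed.

Lemma blockW_ge n : INR n <= blockW n.
Proof. by apply: INR_leq; apply: leqW; apply: divsum_ge. Qed.

Lemma blockW_mono m n : (m <= n)%N -> blockW m <= blockW n.
Proof. by move=> mn; apply: INR_leq; rewrite ltnS divsum_mono. Qed.

(* The error is exactly zero for k = 1, where [j = k - 1 = 0]. *)
Definition err (j n : nat) : R := if j is m.+1 then blockW n ^ m else 0.

Lemma err_ge0 j n : 0 <= err j n.
Proof. by case: j => [|j] /=; [lra | apply: pow_le; have := blockW_ge1 n; lra]. Qed.

Lemma err_mono j m n : (m <= n)%N -> err j m <= err j n.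
Proof.
move=> mn; case: j => [|j] /=; first by lra.
by apply: pow_incr; split; [have := blockW_ge1 m; lra | exact: blockW_mono].
Qed.

Lemma err_mul j n : INR n * err j n <= err j.+1 n.
Proof.
have W1 := blockW_ge1 n; have Wn := blockW_ge n.
case: j => [|j] /=; first by lra.
by apply: Rmult_le_compat_r => //; apply: pow_le; lra.
Qed.

Lemma err_S_ge1 j n : 1 <= err j.+1 n.
Proof. by apply: pow_R1_Rle; apply: blockW_ge1. Qed.

(** The remainder after the linear term in [p] has order n^(j-1), and n <= [blockW n]. For j = 0 it
    vanishes, as [err 0] demands. *)
Lemma pow_sub_linear p j : exists C, 0 <= C /\ forall n, (p <= n)%N ->
  Rabs (INR n ^ j.+1 - INR (n - p)%N ^ j.+1 - INR j.+1 * INR p * INR n ^ j) <= C * err j n.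
Proof.
have P0 : 0 <= INR p by apply: pos_INR.
elim: j => [|j [C [C0 IH]]].
  exists 0; split=> [|n pn]; first by lra.
  rewrite INR_subn //= (_ : _ - _ - _ = 0) ?Rabs_R0; [lra | ring].
have J0 : 0 <= INR j.+1 by apply: pos_INR.
have JP0 : 0 <= INR j.+1 * INR p ^ 2 by apply: Rmult_le_pos => //; apply: pow2_ge_0.
exists (INR j.+1 * INR p ^ 2 + C); split=> [|n pn]; first by lra.
have := IH n pn; rewrite INR_subn //.
set x := INR n; set y := INR p; set D := (_ - _ * x ^ j) => hD.
have yx : y <= x by apply: INR_leq.
have -> : x ^ j.+2 - (x - y) ^ j.+2 - INR j.+2 * y * x ^ j.+1 =
    (x - y) * D - INR j.+1 * y ^ 2 * x ^ j.
  by rewrite /D [INR j.+2]S_INR /=; ring.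
apply: Rle_trans (Rabs_triang _ _) _.
rewrite Rabs_Ropp Rabs_mult Rmult_plus_distr_r Rplus_comm.
have x0 : 0 <= x by apply: pos_INR.
apply: Rplus_le_compat.
  rewrite Rabs_right; last first.
    by apply/Rle_ge/Rmult_le_pos => //; apply: pow_le.
  apply: Rmult_le_compat_l => //.
  by apply: pow_incr; split; [lra | exact: blockW_ge].
rewrite Rabs_right; last by lra.
apply: (Rle_trans _ (x * (C * err j n))).
  by apply: Rmult_le_compat => //; [lra | exact: Rabs_pos | rewrite -/y in P0; lra].
rewrite (_ : x * _ = C * (x * err j n)); last by ring.
by apply: Rmult_le_compat_l => //; apply: err_mul.
Qed.

Lemma bounded_below (f : nat -> R) p : exists M, 0 <= M /\ forall n, (n < p)%N -> Rabs (f n) <= M.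
Proof.
elim: p => [|p [M [M0 IH]]]; first by exists 0; split=> //; lra.
exists (M + Rabs (f p)); have fp := Rabs_pos (f p); split=> [|n]; first by lra.
by rewrite ltnS leq_eqVlt => /orP[/eqP->|/IH]; lra.
Qed.

Lemma leq_sum_ord (H : nat -> nat) m n : (m <= n)%N ->
  (\sum_(i < m) H i <= \sum_(i < n) H i)%N.
Proof.
move=> mn; rewrite -!(big_mkord xpredT H) [X in (_ <= X)%N](@big_cat_nat _ _ _ m) //.
exact: leq_addr.
Qed.

(* The main term solves the recurrence up to [err j], and a recurrence of step
   p accumulates at most n such errors. *)
Lemma recurrence_asymptotics (F G : nat -> R) (H : nat -> nat) p j c C :
  (0 < p)%N ->
  (forall n, (p <= n)%N -> F n + INR (H (n - p)%N) = F (n - p)%N + G n) ->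
  (forall n, Rabs (G n - c * INR n ^ j) <= C * err j n) ->
  (forall n, INR (\sum_(i < n.+1) H i) <= err j.+1 n) ->
  exists C', forall n,
    Rabs (F n - c / (INR j.+1 * INR p) * INR n ^ j.+1) <= C' * err j.+1 n.
Proof.
move=> p0 rec hG hH.
(* With this [e], the increment of e n^(j+1) over a step [p] has leading term c n^j, matching
   [G]. *)
set e := c / _; pose D n := F n - e * INR n ^ j.+1.
have [Cp [Cp0 hp]] := pow_sub_linear p j.
have [M [M0 hM]] := bounded_below D p.
pose B := Rabs C + Rabs e * Cp.
have B0 : 0 <= B.
  by rewrite /B; have := Rabs_pos C; have := Rmult_le_pos _ _ (Rabs_pos e) Cp0; lra.
have pR : 0 < INR p by apply: (lt_INR 0); apply/ltP.
have jR : 0 < INR j.+1 by apply: (lt_INR 0); apply/ltP.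
have step n : (p <= n)%N -> Rabs (D n) <= Rabs (D (n - p)%N) + B * err j n + INR (H (n - p)%N).
  move=> pn; have h := rec n pn; have h1 := hG n; have h2 := hp n pn.
  set X := (_ - _ * INR n ^ j) in h2.
  have -> : D n = D (n - p)%N + (G n - c * INR n ^ j) - e * X - INR (H (n - p)%N).
    rewrite /D /X (_ : F n = F (n - p)%N + G n - INR (H (n - p)%N)); last by lra.
    rewrite /e; field; lra.
  have e0 := err_ge0 j n.
  have h3 : Rabs (G n - c * INR n ^ j) <= Rabs C * err j n.
    apply: Rle_trans h1 _; apply: Rmult_le_compat_r => //; exact: Rle_abs.
  have h4 : Rabs (e * X) <= Rabs e * (Cp * err j n).
    by rewrite Rabs_mult; apply: Rmult_le_compat_l => //; exact: Rabs_pos.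
  have H0 : 0 <= INR (H (n - p)%N) := pos_INR _.
  have t1 := Rabs_triang (D (n - p)%N + (G n - c * INR n ^ j) - e * X) (- INR (H (n - p)%N)).
  have t2 := Rabs_triang (D (n - p)%N + (G n - c * INR n ^ j)) (- (e * X)).
  have t3 := Rabs_triang (D (n - p)%N) (G n - c * INR n ^ j).
  rewrite !Rabs_Ropp (Rabs_right (INR _)) in t1 t2; last by lra.
  by rewrite /B Rmult_plus_distr_r Rmult_assoc; rewrite /Rminus in t1 t2 t3 h3 *; lra.
(* [M] covers the initial values, each of at most [n] steps costs [B * err j n], and the indices n -
   p, n - 2p, ... are distinct, so each value of [H] enters at most once. *)
have bound n : Rabs (D n) <= M + INR n * (B * err j n) + INR (\sum_(i < n) H i).
  elim/ltn_ind: n => n IH.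
  have S0 m : 0 <= INR (\sum_(i < m) H i) := pos_INR _.
  have E0 m : 0 <= B * err j m by apply: Rmult_le_pos => //; exact: err_ge0.
  case: (ltnP n p) => [/hM|pn].
    by have := Rmult_le_pos _ _ (pos_INR n) (E0 n); have := S0 n; lra.
  have np : (n - p < n)%N by lia.
  have := step n pn; have := IH _ np.
  have : INR (\sum_(i < n - p) H i) + INR (H (n - p)%N) <= INR (\sum_(i < n) H i).
    rewrite -plus_INR; apply: INR_leq.
    by have := leq_sum_ord H np; rewrite big_ord_recr.
  have : INR (n - p)%N * (B * err j (n - p)%N) <= (INR n - 1) * (B * err j n).
    apply: Rmult_le_compat; [exact: pos_INR | exact: E0 | |].
      rewrite INR_subn //; suff : 1 <= INR p by lra.
      by rewrite -[1]/(INR 1); apply: INR_leq.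
    by apply: Rmult_le_compat_l => //; apply: err_mono; lia.
  lra.
exists (M + B + 1) => n; rewrite -/(D n); apply: Rle_trans (bound n) _.
have h1 := err_S_ge1 j n; have h2 := err_mul j n.
have h3 : INR (\sum_(i < n) H i) <= err j.+1 n.
  by apply: Rle_trans (hH n); apply: INR_leq; apply: leq_sum_ord.
have : INR n * (B * err j n) <= B * err j.+1 n.
  by rewrite (_ : _ * (B * _) = B * (INR n * err j n)); [apply: Rmult_le_compat_l | ring].
have : M * 1 <= M * err j.+1 n by apply: Rmult_le_compat_l.
lra.
Qed.

(** * The main term by induction *)

(** The factor at j = 0 is the step of the recurrence, and k+1 comes from summing n^k. Passing to
    [behead s] shifts both j and the bound by one, leaving the other factors unchanged. *)
Lemma main_denom_rec k s : main_denom k.+2 s =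
  (k.+1 * (k.+2 - head 0 s) * main_denom k.+1 (behead s))%N.
Proof.
rewrite /main_denom /= factS big_ord_recl addn0 -nth0 -!mulnA; congr (_ * _)%N.
rewrite mulnCA; congr (_ * (_ * _))%N; apply: eq_bigr => i _.
by rewrite nth_behead /= /bump /= add1n addnS subSS.
Qed.

(** Here [k] is one less than in the theorem, hence the degree of the main term. *)
Lemma Av_card_asymptotics k s :
  sorted gtn (k.+2 :: s) -> all (fun x => (0 < x)%N) s -> (head 0 s < k.+1)%N ->
  exists C, forall n,
    Rabs (INR (Av_card n (k.+2 :: s)) - INR n ^ k / INR (main_denom k.+1 s)) <= C * err k n.
Proof.
elim: k s => [|k IH] s ss ps hs.
  have -> : s = [::] by case: (s) ps hs => // x l /= /andP[]; lia.
  exists 0 => n; rewrite Av_card2 /main_denom big_ord_recl big_ord0 /=.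
  by rewrite (_ : 1 - _ = 0) ?Rabs_R0; [lra | field].
have [|||C hC] := IH (behead s).
- case: s ss {ps} hs => // x [|y l] //= /and3P[_ yx ->] xk; rewrite andbT; lia.
- by case: (s) ps => //= x l /andP[].
- by case: (s) ss hs => // x [|y l] //= /and3P[_ h _]; lia.
pose p := (k.+2 - head 0 s)%N.
have p0 : (0 < p)%N by rewrite subn_gt0.
have [|||C' hC'] := @recurrence_asymptotics
  (fun n => INR (Av_card n (k.+3 :: s))) (fun n => INR (Av_card n (k.+2 :: behead s)))
  (fun n => Av_card n s) p k (/ INR (main_denom k.+1 (behead s))) C p0.
- move=> n pn; rewrite -!plus_INR; congr INR.
  exact: Av_card_rec.
- by move=> n; rewrite Rmult_comm; apply: hC.
- move=> n; rewrite /= -INR_expn; apply: INR_leq.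
  (* [head 0 s <= k.+1] allows at most [k] distinct sizes, which matches [err k.+1], the [k]-th
     power of [blockW]. *)
  apply: sum_Av_card_le => //; exact: path_sorted ss.
exists C' => n; have := hC' n; rewrite main_denom_rec -/p !mult_INR.
rewrite /Rdiv !Rinv_mult => h; apply: Rle_trans h; right.
by congr Rabs; congr Rminus; ring.
Qed.

(** * The logarithmic bound and the conclusion *)

(** This is 1 + y <= exp y at y = ln ((m+1)/(m+2)). *)
Lemma harmonic_ln m : 1 / INR m.+2 <= ln (INR m.+2) - ln (INR m.+1).
Proof.
have a0 : 0 < INR m.+1 by apply: (lt_INR 0); apply/ltP.
have b0 : 0 < INR m.+2 by apply: (lt_INR 0); apply/ltP.
have q0 : 0 < INR m.+1 / INR m.+2 by apply: Rdiv_lt_0_compat.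
have := exp_ineq1_le (ln (INR m.+1 / INR m.+2)); rewrite exp_ln //.
rewrite /Rdiv ln_mult ?ln_Rinv //; last exact: Rinv_0_lt_compat.
have : INR m.+1 * / INR m.+2 = 1 - 1 / INR m.+2.
  by rewrite (S_INR m.+1); field; rewrite -S_INR; lra.
lra.
Qed.

Lemma divsum_le n : (0 < n)%N -> INR (divsum n) <= INR n * (1 + ln (INR n)).
Proof.
move=> n0; have N0 : 0 <= INR n by apply: pos_INR.
have dv t : (0 < t)%N -> INR (n %/ t)%N <= INR n * (1 / INR t).
  move=> t0; have tR : 0 < INR t by apply: (lt_INR 0); apply/ltP.
  apply: (Rmult_le_reg_r (INR t)) => //.
  rewrite -mult_INR (_ : _ * _ * _ = INR n); last by field; lra.
  by apply: INR_leq; apply: leq_trunc_div.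
rewrite /divsum; suff H m : INR (\sum_(1 <= t < m.+2) n %/ t)%N <= INR n * (1 + ln (INR m.+1)).
  by case: n n0 {N0 dv} H => // n _ H; apply: H.
elim: m => [|m IH].
  by rewrite big_nat1 divn1 /= ln_1; lra.
rewrite big_nat_recr //= plus_INR.
have := dv m.+2 isT; have := Rmult_le_compat_l _ _ _ N0 (harmonic_ln m).
rewrite -/(INR m.+2) -/(INR m.+1); lra.
Qed.

Lemma ln_ge1 n : (3 <= n)%N -> 1 <= ln (INR n).
Proof.
move=> n3; have [h|<-] : exp 1 <= INR n; last by rewrite ln_exp; lra.
  apply: Rle_trans exp_le_3 _; rewrite (_ : 3 = INR 3); last by rewrite /=; ring.
  exact: INR_leq.
by have := ln_increasing _ _ (exp_pos 1) h; rewrite ln_exp; lra.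
Qed.

Lemma blockW_le n : (3 <= n)%N -> blockW n <= 3 * (INR n * ln (INR n)).
Proof.
move=> n3; have L1 := ln_ge1 n3.
have N1 : 1 <= INR n by rewrite -[1]/(INR 1); apply: INR_leq; lia.
have := @divsum_le n; rewrite /blockW S_INR => /(_ (ltnW (ltnW n3))).
(* Each of n ln n, n and 1 is at most n ln n. *)
by nra.
Qed.

Lemma sigma_div_ge i n : (0 < n)%N -> (n ^ i <= sigma_div i n)%N.
Proof.
move=> n0; rewrite /sigma_div (bigD1_seq n) ?divisors_uniq //=; first exact: leq_addr.
by rewrite -dvdn_divisors.
Qed.

Theorem mainTheorem17 (k : nat) (s : seq nat) :
  (1 <= k)%N ->
  sorted (fun x y => (y < x)%N) (k.+1 :: s) ->
  all (fun x => (0 < x)%N) s ->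
  (nth 0%N s 0 < k)%N ->
  let E := fun n : nat =>
    INR (Av_card n (k.+1 :: s)) - INR n ^ (k - 1)%N / INR (main_denom k s) in
  (k = 1%N -> forall n : nat, E n = 0) /\
  (k = 2%N -> exists C : R, forall n : nat, Rabs (E n) <= C) /\
  ((3 <= k)%N -> exists (C : R) (N : nat), forall n : nat, (N <= n)%N ->
      Rabs (E n) <= C * INR (sigma_div (k - 2)%N n) * ln (INR n) ^ (k - 1)%N).
Proof.
case: k => // k _ ss ps; rewrite nth0 => hs; rewrite subn1 subSS /=.
have [C hC] := Av_card_asymptotics ss ps hs.
split; last split.
- case=> k0 n; subst k; have := hC n; rewrite /= Rmult_0_r.
  set x := (X in Rabs X) => h; case: (Req_dec x 0) => // /Rabs_pos_lt; lra.
- case=> k1; subst k; exists C => n; have := hC n; rewrite /=; lra.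
- case: k ss hs hC => [|[|k]] // ss hs hC _.
(* The power of 3 comes from [blockW_le], and n >= 3 ensures ln n >= 1. *)
exists (Rabs C * 3 ^ k.+1), 3%N => n n3.
have L1 := ln_ge1 n3; have N0 : 0 <= INR n := pos_INR n.
have L0 m : 0 <= ln (INR n) ^ m by apply: pow_le; lra.
have W0 : 0 <= blockW n by have := blockW_ge1 n; lra.
have C0 := Rabs_pos C.
apply: Rle_trans (hC n) _.
apply: (Rle_trans _ (Rabs C * blockW n ^ k.+1)).
  by apply: Rmult_le_compat_r; [exact: pow_le | exact: Rle_abs].
rewrite (Rmult_assoc (Rabs C * _)) (Rmult_assoc (Rabs C)); apply: Rmult_le_compat_l => //.
apply: (Rle_trans _ ((3 * (INR n * ln (INR n))) ^ k.+1)).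
  by apply: pow_incr; split=> //; exact: blockW_le.
rewrite !Rpow_mult_distr; apply: Rmult_le_compat_l; first by apply: pow_le; lra.
apply: Rmult_le_compat => //; first exact: pow_le.
  by rewrite -INR_expn !subSS subn0; apply: INR_leq; apply: sigma_div_ge; lia.
(* The stated bound has one more logarithm than the error, and ln n >= 1. *)
by apply: Rle_pow => //; lia.
Qed.
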